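(* Let $\lambda\in(-\pi/2,\pi/2)$ and $p\in\mathcal{P}_\lambda$. Then for $z\in\mathbb{D}$ with $r=|z|<1$, $$\left|p(z)-\left(\frac{1}{1-r^2}+\frac{r^2}{1-r^2}e^{-2i\lambda}\right)\right|\le\frac{2r\cos\lambda}{1-r^2}.$$ In particular, $$\frac{1+r^2\cos2\lambda-2r\cos\lambda}{1-r^2}\le\operatorname{Re}p(z)\le\frac{1+r^2\cos2\lambda+2r\cos\lambda}{1-r^2}$$ and $$\frac{1}{A(\lambda,r)}\le|p(z)|\le A(\lambda,r),\qquad A(\lambda,r)=\frac{\sqrt{(1-r^2)^2+4r^2\cos^2\lambda}+2r\cos\lambda}{1-r^2}.$$ These inequalities are sharp, with extremal functions of the form $z\mapsto p_\lambda(xz)$, $|x|=1$ (that is, for each $z\in\mathbb{D}$ equality in each of them is attained by a function of this form).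
   Context: $\mathbb{D}$ is the open unit disc, $\mathcal{A}_0$ is the set of analytic functions $f$ on $\mathbb{D}$ with $f(0)=1$. $\mathcal{P}_\lambda=\{p\in\mathcal{A}_0:\ \operatorname{Re}(e^{i\lambda}p(z))>0 \text{ for all } z\in\mathbb{D}\}$, and $p_\lambda(z)=\dfrac{1+e^{-2i\lambda}z}{1-z}$. *)

(* Defs.v *)
From Stdlib Require Import Reals.
From Coquelicot Require Import Coquelicot.
Open Scope R_scope.

(* The complex number e^{it}, by Euler's formula. *)
Definition expi (t : R) : C := (cos t, sin t).

Definition unit_disc (z : C) : Prop := Cmod z < 1.

(* Complex differentiability at every point of the open disc: the derivative is
   taken over the field C_AbsRing.  Functions on the disc are total functions
   on C whose values outside the disc are never constrained. *)
Definition analytic_on_disc (f : C -> C) : Prop :=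
  forall z : C, unit_disc z -> @ex_derive C_AbsRing C_NormedModule f z.

Definition class_A0 (f : C -> C) : Prop :=
  analytic_on_disc f /\ f (RtoC 0) = RtoC 1.

Definition class_P (lambda : R) (p : C -> C) : Prop :=
  class_A0 p /\
  forall z : C, unit_disc z -> 0 < Re (expi lambda * p z)%C.

Definition p_ext (lambda : R) (z : C) : C :=
  ((1 + expi (- (2 * lambda)) * z) / (1 - z))%C.

Definition A_bound (lambda r : R) : R :=
  (sqrt ((1 - r ^ 2) ^ 2 + 4 * r ^ 2 * cos lambda ^ 2) + 2 * r * cos lambda)
  / (1 - r ^ 2).

(* Main.v *)
Require Import Defs.
From Stdlib Require Import Reals Lra.
From Coquelicot Require Import Coquelicot.
Open Scope R_scope.

(** For [p] in the class, [omega = (p - 1) / (p + e^(-2 i lambda))] maps the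
    disc into itself and 0 to 0: the values of [p] lie in a half-plane, and the
    denominator measures the distance to the reflection of 1 in the boundary of
    that half-plane ([half_plane_nearer_to_1]).  Schwarz's lemma gives
    [|p(z) - 1| <= r |p(z) + e^(-2 i lambda)|], which describes a disc of
    Apollonius, the one of the theorem ([apollonius_disc]).  The bounds on the
    real part and on the modulus are read off from its center [c] and radius
    [R]: [A(lambda, r) = |c| + R], and [|c|^2 - R^2 = 1] makes [|c| - R] its
    reciprocal.  The function [p_lambda] maps the circle of radius [r] onto the
    whole boundary of the disc ([p_ext_attains_boundary]), so each bound is
    attained by a suitable rotation.

    Schwarz's lemma has to be derived for functions that are merely
    differentiable at each point, which takes a form of Cauchy's theorem.
    Bisection of rectangles shows that a closed differential form with
    differentiable coefficients has zero circulation ([goursat]).  In the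
    logarithmic coordinate [s + it], this makes the mean of [Re G] over the
    circle of radius [e^s] independent of [s] ([Re_center_le_circle]).  Disc
    automorphisms carry the resulting inequality from 0 to every point and give
    a maximum principle in which only the values near the boundary count
    ([maximum_principle]).  It applies to [z (f(z)/z)^n], which is
    differentiable at 0 as well, and letting [n] grow yields [|f(z)| <= |z|]
    ([schwarz_lemma]). *)

(** * Goursat's lemma on rectangles *)

Record rectangle : Set := Rect { xmin : R; xmax : R; ymin : R; ymax : R }.

Definition subrectangle (q k : rectangle) : Prop :=
  xmin k <= xmin q <= xmax q /\ xmax q <= xmax k /\
  ymin k <= ymin q <= ymax q /\ ymax q <= ymax k.

Definition in_rectangle (x y : R) (q : rectangle) : Prop :=
  xmin q <= x <= xmax q /\ ymin q <= y <= ymax q.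

Definition diameter (q : rectangle) : R :=
  Rmax (xmax q - xmin q) (ymax q - ymin q).

Definition xmid (q : rectangle) : R := (xmin q + xmax q) / 2.
Definition ymid (q : rectangle) : R := (ymin q + ymax q) / 2.

Definition left_half (q : rectangle) : rectangle :=
  Rect (xmin q) (xmid q) (ymin q) (ymax q).
Definition right_half (q : rectangle) : rectangle :=
  Rect (xmid q) (xmax q) (ymin q) (ymax q).
Definition lower_half (q : rectangle) : rectangle :=
  Rect (xmin q) (xmax q) (ymin q) (ymid q).
Definition upper_half (q : rectangle) : rectangle :=
  Rect (xmin q) (xmax q) (ymid q) (ymax q).

Definition larger (Phi : rectangle -> R) (q k : rectangle) : rectangle :=
  if Rle_dec (Rabs (Phi q)) (Rabs (Phi k)) then k else q.

Definition worst_quarter (Phi : rectangle -> R) (q : rectangle) : rectangle :=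
  let h := larger Phi (left_half q) (right_half q) in
  larger Phi (lower_half h) (upper_half h).

Lemma larger_cases (Phi : rectangle -> R) (q k : rectangle) :
  (larger Phi q k = q \/ larger Phi q k = k) /\
  Rabs (Phi q + Phi k) <= 2 * Rabs (Phi (larger Phi q k)).
Proof.
  unfold larger.
  pose proof (Rabs_triang (Phi q) (Phi k)).
  destruct (Rle_dec (Rabs (Phi q)) (Rabs (Phi k))); split; auto; lra.
Qed.

Lemma worst_quarter_spec (Phi : rectangle -> R) (k q : rectangle)
  (split_x : forall q, subrectangle q k ->
     Phi q = Phi (left_half q) + Phi (right_half q))
  (split_y : forall q, subrectangle q k ->
     Phi q = Phi (lower_half q) + Phi (upper_half q)) :
  subrectangle q k ->
  subrectangle (worst_quarter Phi q) q /\
  diameter (worst_quarter Phi q) = diameter q / 2 /\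
  Rabs (Phi q) <= 4 * Rabs (Phi (worst_quarter Phi q)).
Proof.
  intros Hq. unfold worst_quarter.
  destruct (larger_cases Phi (left_half q) (right_half q)) as [Eh Bh].
  rewrite <- (split_x q Hq) in Bh.
  set (h := larger Phi (left_half q) (right_half q)) in *.
  assert (Hh : subrectangle h q /\ xmax h - xmin h = (xmax q - xmin q) / 2 /\
               ymin h = ymin q /\ ymax h = ymax q).
  { unfold subrectangle in *.
    destruct Eh as [-> | ->]; simpl; unfold xmid; lra. }
  destruct Hh as (Hh & Wx & Wy0 & Wy1).
  assert (Hk : subrectangle h k) by (unfold subrectangle in *; lra).
  destruct (larger_cases Phi (lower_half h) (upper_half h)) as [Eg Bg].
  rewrite <- (split_y h Hk) in Bg.
  set (g := larger Phi (lower_half h) (upper_half h)) in *.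
  assert (Hg : subrectangle g h /\ xmax g - xmin g = (xmax q - xmin q) / 2 /\
               ymax g - ymin g = (ymax q - ymin q) / 2).
  { unfold subrectangle in *.
    destruct Eg as [-> | ->]; simpl; unfold ymid; lra. }
  destruct Hg as (Hg & Vx & Vy).
  split; [unfold subrectangle in *; lra | split; [| lra]].
  unfold diameter. rewrite Vx, Vy. unfold Rmax, Rdiv.
  destruct (Rle_dec (xmax q - xmin q)), (Rle_dec ((xmax q - xmin q) * _)); lra.
Qed.

Lemma nested_intervals (a b : nat -> R) :
  (forall n, a n <= a (S n)) -> (forall n, b (S n) <= b n) ->
  (forall n, a n <= b n) ->
  exists x, forall n, a n <= x <= b n.
Proof.
  intros Ha Hb Hab.
  assert (Ma : forall n k, a n <= a (k + n)%nat).
  { intros n k; induction k; simpl; [lra | specialize (Ha (k + n)%nat); lra]. }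
  assert (Mb : forall n k, b (k + n)%nat <= b n).
  { intros n k; induction k; simpl; [lra | specialize (Hb (k + n)%nat); lra]. }
  assert (Hcross : forall n m, a n <= b m).
  { intros n m. specialize (Ma n m). specialize (Mb m n). specialize (Hab (m + n)%nat).
    rewrite Nat.add_comm in Mb. lra. }
  destruct (completeness (fun v => exists n, v = a n)) as [x [Hub Hlub]].
  - exists (b 0%nat). intros v [n ->]. apply Hcross.
  - exists (a 0%nat). now exists 0%nat.
  - exists x. intros n. split.
    + apply Hub. now exists n.
    + apply Hlub. intros v [m ->]. apply Hcross.
Qed.

(** Bisection: each time the quarter on which [Phi] is largest keeps at least a
    quarter of [|Phi|], while the square of the diameter is divided by 4.  If
    [Phi k] were not 0, [Phi] would not be negligible against that square near
    the point to which the quarters shrink. *)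
Lemma additive_rectangle_function_zero (Phi : rectangle -> R) (k : rectangle)
  (split_x : forall q, subrectangle q k ->
     Phi q = Phi (left_half q) + Phi (right_half q))
  (split_y : forall q, subrectangle q k ->
     Phi q = Phi (lower_half q) + Phi (upper_half q))
  (small : forall x y eps, in_rectangle x y k -> 0 < eps ->
     exists delta, 0 < delta /\
       forall q, subrectangle q k -> in_rectangle x y q -> diameter q < delta ->
         Rabs (Phi q) <= eps * diameter q ^ 2) :
  subrectangle k k -> Phi k = 0.
Proof.
  intros Hk.
  set (q := fun n => Nat.iter n (worst_quarter Phi) k).
  assert (Hq : forall n, subrectangle (q n) k).
  { induction n as [|n IH]; [exact Hk |].
    destruct (worst_quarter_spec Phi k (q n) split_x split_y IH) as [H _].
    change (q (S n)) with (worst_quarter Phi (q n)).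
    unfold subrectangle in *; lra. }
  assert (Hstep : forall n, subrectangle (q (S n)) (q n) /\
            diameter (q (S n)) = diameter (q n) / 2 /\
            Rabs (Phi (q n)) <= 4 * Rabs (Phi (q (S n)))).
  { intros n. exact (worst_quarter_spec Phi k (q n) split_x split_y (Hq n)). }
  assert (Hdiam : forall n, diameter (q n) = diameter k * (/ 2) ^ n).
  { induction n as [|n IH]; [simpl; lra |].
    rewrite (proj1 (proj2 (Hstep n))), IH. simpl. lra. }
  assert (Hphi : forall n, Rabs (Phi k) * ((/ 2) ^ n) ^ 2 <= Rabs (Phi (q n))).
  { induction n as [|n IH]; [simpl; lra |].
    pose proof (proj2 (proj2 (Hstep n))). simpl in *. lra. }
  destruct (nested_intervals (fun n => xmin (q n)) (fun n => xmax (q n))) as [x Hx];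
    [intros n; generalize (proj1 (Hstep n)) (Hq n); unfold subrectangle; lra .. |].
  destruct (nested_intervals (fun n => ymin (q n)) (fun n => ymax (q n))) as [y Hy];
    [intros n; generalize (proj1 (Hstep n)) (Hq n); unfold subrectangle; lra .. |].
  destruct (Req_dec (Phi k) 0) as [E | NE]; [exact E | exfalso].
  pose proof (Rabs_pos_lt _ NE) as Hpos.
  assert (D0 : 0 <= diameter k ^ 2) by apply pow2_ge_0.
  set (eps := Rabs (Phi k) / (2 * (diameter k ^ 2 + 1))).
  assert (Heps : 0 < eps) by (apply Rdiv_lt_0_compat; lra).
  assert (Hbeat : eps * diameter k ^ 2 < Rabs (Phi k)).
  { unfold eps. apply (Rmult_lt_reg_r (2 * (diameter k ^ 2 + 1))); [lra |].
    field_simplify; [nra | lra]. }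
  destruct (small x y eps) as (delta & Hdelta & Hsmall);
    [exact (conj (Hx 0%nat) (Hy 0%nat)) | exact Heps |].
  assert (Dk : 0 <= diameter k).
  { unfold subrectangle in Hk. unfold diameter.
    apply Rle_trans with (2 := Rmax_l _ _); lra. }
  destruct (pow_lt_1_zero (/ 2)) with (y := delta / (diameter k + 1)) as [N HN];
    [rewrite Rabs_pos_eq; lra | apply Rdiv_lt_0_compat; lra |].
  specialize (HN N (Nat.le_refl N)).
  assert (P : 0 < (/ 2) ^ N) by (apply pow_lt; lra).
  rewrite Rabs_pos_eq in HN by lra.
  assert (HdN : diameter (q N) < delta).
  { rewrite Hdiam. apply (Rmult_lt_compat_r (diameter k + 1)) in HN; [| lra].
    replace (delta / (diameter k + 1) * (diameter k + 1)) with delta in HN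
      by (field; lra). nra. }
  specialize (Hsmall (q N) (Hq N) (conj (Hx N) (Hy N)) HdN).
  specialize (Hphi N). rewrite Hdiam in Hsmall.
  assert (0 < ((/ 2) ^ N) ^ 2) by (apply pow_lt; lra).
  rewrite Rpow_mult_distr in Hsmall. nra.
Qed.

Definition circulation (P Q : R -> R -> R) (q : rectangle) : R :=
  RInt (fun x => P x (ymin q)) (xmin q) (xmax q)
  + RInt (fun y => Q (xmax q) y) (ymin q) (ymax q)
  - RInt (fun x => P x (ymax q)) (xmin q) (xmax q)
  - RInt (fun y => Q (xmin q) y) (ymin q) (ymax q).

Lemma ex_RInt_horizontal (P : R -> R -> R) (a b y : R) : a <= b ->
  (forall x, a <= x <= b -> continuity_2d_pt P x y) ->
  ex_RInt (fun x => P x y) a b.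
Proof.
  intros Hab H. apply (@ex_RInt_continuous R_CompleteNormedModule).
  rewrite Rmin_left, Rmax_right by lra. intros x Hx.
  apply continuity_pt_filterlim. intros eps He.
  destruct (H x Hx (mkposreal eps He)) as [d Hd].
  exists d; split; [apply cond_pos |]. intros u [_ Hu].
  apply Hd; [exact Hu | rewrite Rminus_diag, Rabs_R0; apply cond_pos].
Qed.

Lemma ex_RInt_vertical (Q : R -> R -> R) (c d x : R) : c <= d ->
  (forall y, c <= y <= d -> continuity_2d_pt Q x y) ->
  ex_RInt (fun y => Q x y) c d.
Proof.
  intros Hcd H. apply (ex_RInt_horizontal (fun y x => Q x y)); [exact Hcd |].
  intros y Hy eps. destruct (H y Hy eps) as [e He]. exists e.
  intros u v Hu Hv. now apply He.
Qed.

(** Applied to a coefficient of the form along two opposite sides, where the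
    difference of the two functions is nearly constant. *)
Lemma RInt_difference_bound (f g : R -> R) (a b l M : R) : a <= b ->
  ex_RInt f a b -> ex_RInt g a b ->
  (forall t, a <= t <= b -> Rabs (f t - g t - l) <= M) ->
  Rabs (RInt f a b - RInt g a b - (b - a) * l) <= (b - a) * M.
Proof.
  intros Hab Hf Hg H.
  pose proof (@ex_RInt_minus R_NormedModule f g a b Hf Hg) as Hfg.
  pose proof (@ex_RInt_const R_NormedModule a b l) as Hl.
  replace (RInt f a b - RInt g a b - (b - a) * l)
    with (RInt (fun t => f t - g t - l) a b).
  - apply abs_RInt_le_const; [exact Hab | | exact H].
    exact (@ex_RInt_minus R_NormedModule _ _ a b Hfg Hl).
  - rewrite (@RInt_minus R_CompleteNormedModule (fun t => f t - g t) (fun _ => l));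
      [| exact Hfg | exact Hl].
    rewrite (@RInt_minus R_CompleteNormedModule f g); [| exact Hf | exact Hg].
    rewrite (@RInt_const R_CompleteNormedModule). reflexivity.
Qed.

(** The derivatives may be discontinuous, so the circulation cannot be written
    as a double integral of [Qx - Py]; bisection localizes it at a point
    instead.  There the affine parts of [P] and [Q] contribute [Qx - Py] times
    the area, that is nothing, since [m] stands for both partial derivatives,
    and the remainders are negligible against the square of the diameter. *)
Lemma goursat (P Q : R -> R -> R) (k : rectangle)
  (closed_form : forall x y, in_rectangle x y k -> exists px m qy,
     differentiable_pt_lim P x y px m /\ differentiable_pt_lim Q x y m qy) :
  subrectangle k k -> circulation P Q k = 0.
Proof.
  assert (CP : forall x y, in_rectangle x y k -> continuity_2d_pt P x y).
  { intros x y H. destruct (closed_form x y H) as (px & m & qy & HP & _).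
    apply differentiable_continuity_pt. now exists px, m. }
  assert (CQ : forall x y, in_rectangle x y k -> continuity_2d_pt Q x y).
  { intros x y H. destruct (closed_form x y H) as (px & m & qy & _ & HQ).
    apply differentiable_continuity_pt. now exists m, qy. }
  assert (IP : forall a b y, xmin k <= a <= b -> b <= xmax k ->
            ymin k <= y <= ymax k -> ex_RInt (fun x => P x y) a b).
  { intros a b y Ha Hb Hy. apply ex_RInt_horizontal; [lra |].
    intros x Hx. apply CP. unfold in_rectangle; lra. }
  assert (IQ : forall c d x, ymin k <= c <= d -> d <= ymax k ->
            xmin k <= x <= xmax k -> ex_RInt (fun y => Q x y) c d).
  { intros c d x Hc Hd Hx. apply ex_RInt_vertical; [lra |].
    intros y Hy. apply CQ. unfold in_rectangle; lra. }
  apply additive_rectangle_function_zero.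
  - intros q Hq. unfold subrectangle in Hq.
    unfold circulation, left_half, right_half, xmid; simpl.
    set (m := (xmin q + xmax q) / 2).
    assert (xmin q <= m <= xmax q) by (unfold m; lra).
    rewrite <- (RInt_Chasles (fun x => P x (ymin q)) (xmin q) m (xmax q)),
            <- (RInt_Chasles (fun x => P x (ymax q)) (xmin q) m (xmax q));
      [unfold plus; simpl; ring | apply IP; lra ..].
  - intros q Hq. unfold subrectangle in Hq.
    unfold circulation, lower_half, upper_half, ymid; simpl.
    set (m := (ymin q + ymax q) / 2).
    assert (ymin q <= m <= ymax q) by (unfold m; lra).
    rewrite <- (RInt_Chasles (fun y => Q (xmin q) y) (ymin q) m (ymax q)),
            <- (RInt_Chasles (fun y => Q (xmax q) y) (ymin q) m (ymax q));
      [unfold plus; simpl; ring | apply IQ; lra ..].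
  - intros x y eps Hxy Heps.
    destruct (closed_form x y Hxy) as (px & m & qy & HP & HQ).
    assert (He4 : 0 < eps / 4) by lra.
    destruct (HP (mkposreal _ He4)) as [d1 Hd1].
    destruct (HQ (mkposreal _ He4)) as [d2 Hd2]. simpl in Hd1, Hd2.
    exists (Rmin d1 d2). split; [apply Rmin_pos; apply cond_pos |].
    intros q Hq Hin Hdiam. unfold subrectangle in Hq.
    set (D := diameter q) in *.
    assert (Dx : xmax q - xmin q <= D) by apply Rmax_l.
    assert (Dy : ymax q - ymin q <= D) by apply Rmax_r.
    pose proof (Rmin_l d1 d2). pose proof (Rmin_r d1 d2).
    unfold in_rectangle in Hin.
    assert (Hnear : forall u v, in_rectangle u v q ->
              Rabs (u - x) <= D /\ Rabs (v - y) <= D).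
    { unfold in_rectangle. intros u v Huv. split; apply Rabs_le; lra. }
    assert (EP : forall u v, in_rectangle u v q ->
              Rabs (P u v - P x y - (px * (u - x) + m * (v - y))) <= eps / 4 * D).
    { intros u v Huv. destruct (Hnear u v Huv) as [Hu Hv].
      eapply Rle_trans; [apply Hd1; lra |].
      apply Rmult_le_compat_l; [lra | now apply Rmax_lub]. }
    assert (EQ : forall u v, in_rectangle u v q ->
              Rabs (Q u v - Q x y - (m * (u - x) + qy * (v - y))) <= eps / 4 * D).
    { intros u v Huv. destruct (Hnear u v Huv) as [Hu Hv].
      eapply Rle_trans; [apply Hd2; lra |].
      apply Rmult_le_compat_l; [lra | now apply Rmax_lub]. }
    assert (BP := RInt_difference_bound
              (fun t => P t (ymin q)) (fun t => P t (ymax q)) (xmin q) (xmax q)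
              (- (m * (ymax q - ymin q))) (eps / 2 * D)).
    assert (BQ := RInt_difference_bound
              (fun t => Q (xmax q) t) (fun t => Q (xmin q) t) (ymin q) (ymax q)
              (m * (xmax q - xmin q)) (eps / 2 * D)).
    assert (BP' := BP ltac:(lra) ltac:(apply IP; lra) ltac:(apply IP; lra)).
    assert (BQ' := BQ ltac:(lra) ltac:(apply IQ; lra) ltac:(apply IQ; lra)).
    clear BP BQ.
    assert (BP : forall t, xmin q <= t <= xmax q ->
      Rabs (P t (ymin q) - P t (ymax q) - - (m * (ymax q - ymin q))) <= eps / 2 * D).
    { intros t Ht.
      pose proof (proj1 (Rabs_le_between _ _) (EP t (ymin q) ltac:(unfold in_rectangle; lra))).
      pose proof (proj1 (Rabs_le_between _ _) (EP t (ymax q) ltac:(unfold in_rectangle; lra))).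
      apply Rabs_le. lra. }
    assert (BQ : forall t, ymin q <= t <= ymax q ->
      Rabs (Q (xmax q) t - Q (xmin q) t - m * (xmax q - xmin q)) <= eps / 2 * D).
    { intros t Ht.
      pose proof (proj1 (Rabs_le_between _ _) (EQ (xmax q) t ltac:(unfold in_rectangle; lra))).
      pose proof (proj1 (Rabs_le_between _ _) (EQ (xmin q) t ltac:(unfold in_rectangle; lra))).
      apply Rabs_le. lra. }
    specialize (BP' BP). specialize (BQ' BQ).
    apply Rabs_le_between in BP'. apply Rabs_le_between in BQ'.
    assert (0 <= eps / 2 * D) by (apply Rmult_le_pos; lra).
    assert ((xmax q - xmin q) * (eps / 2 * D) <= D * (eps / 2 * D))
      by (apply Rmult_le_compat_r; lra).
    assert ((ymax q - ymin q) * (eps / 2 * D) <= D * (eps / 2 * D))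
      by (apply Rmult_le_compat_r; lra).
    unfold circulation. apply Rabs_le. simpl. lra.
Qed.

(** * Complex derivatives *)

Definition C_diff (f : C -> C) (z : C) : Prop :=
  @ex_derive C_AbsRing C_NormedModule f z.

(** [C] is a module over itself in two ways whose norms agree but whose uniform
    structures differ.  The product and chain rules are available for the one of
    this definition, and are transported to the other through
    [has_C_derivative], which mentions the modulus only. *)
Definition C_diff_ring (f : C -> C) (z : C) : Prop :=
  @ex_derive C_AbsRing (AbsRing_NormedModule C_AbsRing) f z.

Definition has_C_derivative (f : C -> C) (z l : C) : Prop :=
  forall eps : posreal, exists d : posreal, forall w : C, Cmod (w - z) < d ->
    Cmod (f w - f z - (w - z) * l)%C <= eps * Cmod (w - z).

Lemma is_derive_module_iff (f : C -> C) (z l : C) :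
  @is_derive C_AbsRing C_NormedModule f z l <-> has_C_derivative f z l.
Proof.
  split.
  - intros [_ H] eps. destruct (H z (fun P h => h) eps) as [d Hd].
    exists d. intros w Hw. exact (Hd w Hw).
  - intros H. split; [apply is_linear_scal_l |]. intros x Hx.
    apply (@is_filter_lim_locally_unique C_AbsRing (AbsRing_NormedModule C_AbsRing)) in Hx.
    subst x. intros eps. destruct (H eps) as [d Hd].
    exists d. intros w Hw. exact (Hd w Hw).
Qed.

Lemma is_derive_ring_iff (f : C -> C) (z l : C) :
  @is_derive C_AbsRing (AbsRing_NormedModule C_AbsRing) f z l <-> has_C_derivative f z l.
Proof.
  split.
  - intros [_ H] eps. destruct (H z (fun P h => h) eps) as [d Hd].
    exists d. intros w Hw. exact (Hd w Hw).
  - intros H. split; [apply is_linear_scal_l |]. intros x Hx.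
    apply (@is_filter_lim_locally_unique C_AbsRing (AbsRing_NormedModule C_AbsRing)) in Hx.
    subst x. intros eps. destruct (H eps) as [d Hd].
    exists d. intros w Hw. exact (Hd w Hw).
Qed.

Lemma C_diff_iff_ring (f : C -> C) (z : C) : C_diff f z <-> C_diff_ring f z.
Proof.
  split; intros [l H]; exists l.
  - exact (proj2 (is_derive_ring_iff f z l) (proj1 (is_derive_module_iff f z l) H)).
  - exact (proj2 (is_derive_module_iff f z l) (proj1 (is_derive_ring_iff f z l) H)).
Qed.

Lemma C_diff_iff (f : C -> C) (z : C) :
  C_diff f z <-> exists l, has_C_derivative f z l.
Proof.
  split; intros [l H]; exists l;
    [exact (proj1 (is_derive_module_iff f z l) H)
    |exact (proj2 (is_derive_module_iff f z l) H)].
Qed.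

Lemma C_diff_const (c z : C) : C_diff (fun _ => c) z.
Proof.
  apply C_diff_iff_ring.
  apply (@ex_derive_const C_AbsRing (AbsRing_NormedModule C_AbsRing)).
Qed.

Lemma C_diff_id (z : C) : C_diff (fun w => w) z.
Proof. apply C_diff_iff_ring, (@ex_derive_id C_AbsRing). Qed.

Lemma C_diff_plus (f g : C -> C) (z : C) :
  C_diff f z -> C_diff g z -> C_diff (fun w => f w + g w)%C z.
Proof.
  rewrite !C_diff_iff_ring. intros Hf Hg.
  exact (@ex_derive_plus C_AbsRing (AbsRing_NormedModule C_AbsRing) f g z Hf Hg).
Qed.

Lemma C_diff_minus (f g : C -> C) (z : C) :
  C_diff f z -> C_diff g z -> C_diff (fun w => f w - g w)%C z.
Proof.
  rewrite !C_diff_iff_ring. intros Hf Hg.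
  exact (@ex_derive_minus C_AbsRing (AbsRing_NormedModule C_AbsRing) f g z Hf Hg).
Qed.

Lemma C_diff_mult (f g : C -> C) (z : C) :
  C_diff f z -> C_diff g z -> C_diff (fun w => f w * g w)%C z.
Proof.
  rewrite !C_diff_iff_ring. intros [l Hf] [m Hg]. eexists.
  exact (@is_derive_mult C_AbsRing f g z l m Hf Hg Cmult_comm).
Qed.

Lemma C_diff_pow (f : C -> C) (n : nat) (z : C) :
  C_diff f z -> C_diff (fun w => f w ^ n)%C z.
Proof.
  intros Hf. induction n as [|n IH]; simpl;
    [apply C_diff_const | now apply C_diff_mult].
Qed.

Lemma C_diff_comp (f g : C -> C) (z : C) :
  C_diff f (g z) -> C_diff g z -> C_diff (fun w => f (g w)) z.
Proof.
  rewrite !C_diff_iff_ring.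
  apply (@ex_derive_comp C_AbsRing (AbsRing_NormedModule C_AbsRing)).
Qed.

Lemma C_diff_continuous (f : C -> C) (z : C) : C_diff f z ->
  forall eps : posreal, exists d : posreal, forall w, Cmod (w - z) < d ->
    Cmod (f w - f z) < eps.
Proof.
  intros Hf eps. apply C_diff_iff in Hf. destruct Hf as [l Hl].
  destruct (Hl (mkposreal 1 Rlt_0_1)) as [d Hd]. simpl in Hd.
  pose proof (Cmod_ge_0 l) as Hl0.
  assert (He : 0 < eps / (2 + Cmod l)).
  { apply Rdiv_lt_0_compat; [apply cond_pos | lra]. }
  exists (mkposreal _ (Rmin_pos _ _ (cond_pos d) He)). simpl. intros w Hw.
  assert (H1 : Cmod (w - z) < d) by (eapply Rlt_le_trans; [exact Hw | apply Rmin_l]).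
  assert (H2 : Cmod (w - z) * (2 + Cmod l) < eps).
  { apply Rlt_le_trans with (eps / (2 + Cmod l) * (2 + Cmod l)).
    - apply Rmult_lt_compat_r; [lra |].
      eapply Rlt_le_trans; [exact Hw | apply Rmin_r].
    - right. field. lra. }
  specialize (Hd w H1).
  replace (f w - f z)%C with ((f w - f z - (w - z) * l) + (w - z) * l)%C by ring.
  eapply Rle_lt_trans; [apply Cmod_triangle |]. rewrite Cmod_mult.
  pose proof (Cmod_ge_0 (w - z)). lra.
Qed.

Lemma Cmod_reverse_triangle (a b : C) : Cmod a - Cmod b <= Cmod (a - b).
Proof.
  pose proof (Cmod_triangle (a - b) b). replace (a - b + b)%C with a in H by ring. lra.
Qed.

Lemma C_diff_Cinv (z : C) : z <> 0 -> C_diff Cinv z.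
Proof.
  intros Hz. apply C_diff_iff. exists (- / (z * z))%C. intros eps.
  pose proof (proj1 (Cmod_gt_0 z) Hz) as Hm.
  set (m := Cmod z) in *.
  assert (He : 0 < Rmin (m / 2) (eps * m ^ 3 / 2)).
  { apply Rmin_pos; [lra |]. apply Rdiv_lt_0_compat; [| lra].
    apply Rmult_lt_0_compat; [apply cond_pos | now apply pow_lt]. }
  exists (mkposreal _ He). simpl. intros w Hw.
  assert (H1 : Cmod (w - z) < m / 2) by (eapply Rlt_le_trans; [exact Hw | apply Rmin_l]).
  assert (H2 : Cmod (w - z) < eps * m ^ 3 / 2)
    by (eapply Rlt_le_trans; [exact Hw | apply Rmin_r]).
  assert (H3 : m / 2 < Cmod w).
  { pose proof (Cmod_reverse_triangle z (z - w)).
    replace (z - (z - w))%C with w in H by ring.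
    rewrite <- Cmod_opp in H1. replace (- (w - z))%C with (z - w)%C in H1 by ring.
    fold m in H. lra. }
  assert (Hw0 : w <> 0) by (apply Cmod_gt_0; lra).
  replace (/ w - / z - (w - z) * (- / (z * z)))%C
    with ((w - z) * ((w - z) / (w * (z * z))))%C by (field; auto).
  rewrite Cmod_mult, Rmult_comm. apply Rmult_le_compat_r; [apply Cmod_ge_0 |].
  rewrite Cmod_div by (repeat apply Cmult_neq_0; auto).
  rewrite !Cmod_mult. fold m.
  assert (0 < m * m) by nra.
  assert (Hpos : 0 < Cmod w * (m * m)) by (apply Rmult_lt_0_compat; lra).
  apply (Rmult_le_reg_r (Cmod w * (m * m))); [exact Hpos |].
  unfold Rdiv. rewrite Rmult_assoc, Rinv_l, Rmult_1_r by lra.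
  pose proof (cond_pos eps).
  apply Rle_trans with (eps * (m / 2 * (m * m))); [nra |].
  apply Rmult_le_compat_l; [lra |]. apply Rmult_le_compat_r; lra.
Qed.

Lemma C_diff_div (f g : C -> C) (z : C) :
  C_diff f z -> C_diff g z -> g z <> 0 -> C_diff (fun w => f w / g w)%C z.
Proof.
  intros Hf Hg H0. apply C_diff_mult; [exact Hf |].
  apply (C_diff_comp Cinv g); [now apply C_diff_Cinv | exact Hg].
Qed.

(** * Mean values over circles *)

(** The Cauchy-Riemann equations, in the sense of total differentials. *)
Lemma cauchy_riemann (f : C -> C) (x y : R) (l : C) :
  has_C_derivative f (x, y) l ->
  differentiable_pt_lim (fun u v => Re (f (u, v))) x y (Re l) (- Im l) /\
  differentiable_pt_lim (fun u v => Im (f (u, v))) x y (Im l) (Re l).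
Proof.
  intros H.
  assert (K : forall eps : posreal, locally_2d (fun u v =>
            Cmod (f (u, v) - f (x, y) - ((u, v) - (x, y)) * l)%C
            <= eps * Rmax (Rabs (u - x)) (Rabs (v - y))) x y).
  { intros eps.
    assert (He : 0 < eps / 2) by (generalize (cond_pos eps); lra).
    destruct (H (mkposreal _ He)) as [d Hd]. simpl in Hd.
    assert (Hd2 : 0 < d / 2) by (generalize (cond_pos d); lra).
    exists (mkposreal _ Hd2). simpl. intros u v Hu Hv.
    assert (B : Cmod ((u, v) - (x, y)) <= 2 * Rmax (Rabs (u - x)) (Rabs (v - y))).
    { eapply Rle_trans; [apply Cmod_2Rmax |]. simpl.
      apply Rmult_le_compat_r;
        [eapply Rle_trans; [apply Rabs_pos | apply Rmax_l] |].
      pose proof (sqrt_sqrt 2). pose proof (sqrt_pos 2). nra. }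
    eapply Rle_trans.
    - apply Hd. eapply Rle_lt_trans; [exact B |].
      pose proof (Rmax_lub_lt _ _ _ Hu Hv). lra.
    - generalize (cond_pos eps). nra. }
  split; intros eps; destruct (K eps) as [d Hd]; exists d; intros u v Hu Hv;
    (eapply Rle_trans; [| exact (Hd u v Hu Hv)]).
  - eapply Rle_trans; [| apply re_le_Cmod]. right. f_equal.
    unfold Re, Im. simpl. ring.
  - eapply Rle_trans; [| apply Rmax_Cmod].
    eapply Rle_trans; [| apply Rmax_r]. right. f_equal.
    unfold Re, Im. simpl. ring.
Qed.

Lemma differentiable_pt_lim_Rmult (x y : R) :
  differentiable_pt_lim Rmult x y y x.
Proof.
  intros eps. exists eps. intros u v Hu Hv.
  replace (u * v - x * y - (y * (u - x) + x * (v - y)))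
    with ((u - x) * (v - y)) by ring.
  rewrite Rabs_mult. apply Rmult_le_compat; try apply Rabs_pos; [lra | apply Rmax_r].
Qed.

Lemma differentiable_pt_lim_product (f g : R -> R) (s t df dg : R) :
  is_derive f s df -> is_derive g t dg ->
  differentiable_pt_lim (fun s t => f s * g t) s t (df * g t) (f s * dg).
Proof.
  intros Hf Hg.
  assert (Hf' : differentiable_pt_lim (fun s _ : R => f s) s t df 0)
    by now apply differentiable_pt_lim_proj1_0, is_derive_Reals.
  assert (Hg' : differentiable_pt_lim (fun _ t : R => g t) s t 0 dg).
  { assert (K : differentiable_pt_lim (fun t _ : R => g t) t s dg 0)
      by now apply differentiable_pt_lim_proj1_0, is_derive_Reals.
    intros eps. destruct (K eps) as [d Hd]. exists d. intros u v Hu Hv.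
    specialize (Hd v u Hv Hu). rewrite Rmax_comm, Rplus_comm. exact Hd. }
  pose proof (differentiable_pt_lim_comp Rmult _ _ s t _ _ _ _ _ _
                (differentiable_pt_lim_Rmult (f s) (g t)) Hf' Hg') as K.
  replace (df * g t) with (g t * df + f s * 0) by ring.
  replace (f s * dg) with (g t * 0 + f s * dg) by ring.
  exact K.
Qed.

(** This is [e^(s+it)]. *)
Definition polar (s t : R) : C := (exp s * cos t, exp s * sin t).

Lemma Cmod_polar (s t : R) : Cmod (polar s t) = exp s.
Proof.
  unfold Cmod, polar. simpl.
  replace (exp s * cos t * (exp s * cos t * 1) + exp s * sin t * (exp s * sin t * 1))
    with (Rsqr (exp s) * (Rsqr (sin t) + Rsqr (cos t))) by (unfold Rsqr; ring).
  rewrite sin2_cos2, Rmult_1_r. apply sqrt_Rsqr, Rlt_le, exp_pos.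
Qed.

(** With [g(s+it) = G(e^(s+it))], the imaginary part of [g(zeta) d zeta] is
    [Im g ds + Re g dt], and it is closed by the Cauchy-Riemann equations. *)
Lemma polar_form_closed (G : C -> C) (s t : R) : C_diff G (polar s t) ->
  exists px m qy,
    differentiable_pt_lim (fun s t => Im (G (polar s t))) s t px m /\
    differentiable_pt_lim (fun s t => Re (G (polar s t))) s t m qy.
Proof.
  intros HG. apply C_diff_iff in HG. destruct HG as [l Hl].
  apply cauchy_riemann in Hl. destruct Hl as [Hre Him].
  pose proof (differentiable_pt_lim_product exp cos s t _ _
                (is_derive_exp s) (is_derive_cos t)) as Hx.
  pose proof (differentiable_pt_lim_product exp sin s t _ _
                (is_derive_exp s) (is_derive_sin t)) as Hy.
  pose proof (differentiable_pt_lim_comp _ _ _ s t _ _ _ _ _ _ Hre Hx Hy) as Kre.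
  pose proof (differentiable_pt_lim_comp _ _ _ s t _ _ _ _ _ _ Him Hx Hy) as Kim.
  eexists _, _, _. split; [exact Kim |].
  replace (Im l * (exp s * - sin t) + Re l * (exp s * cos t))
    with (Re l * (exp s * cos t) + - Im l * (exp s * sin t)) by ring.
  exact Kre.
Qed.

(** The mean of [Re G] over the circle of radius [e^s] does not depend on [s]:
    around the rectangle [[s0, s1] x [0, 2 pi]] the horizontal sides cancel by
    periodicity.  On a small circle it is close to [Re (G 0)]. *)
Lemma Re_center_le_circle (G : C -> C) (rho M : R) :
  analytic_on_disc G -> 0 < rho < 1 ->
  (forall z, Cmod z = rho -> Re (G z) <= M) ->
  Re (G (RtoC 0)) <= M.
Proof.
  intros HG Hrho HM. apply Rnot_lt_le. intros Hlt.
  set (e := (Re (G (RtoC 0)) - M) / 2).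
  assert (He : 0 < e) by (unfold e; lra).
  assert (H0 : unit_disc (RtoC 0)) by (unfold unit_disc; rewrite Cmod_0; lra).
  destruct (C_diff_continuous G (RtoC 0) (HG _ H0) (mkposreal e He)) as [d Hd].
  simpl in Hd. pose proof (cond_pos d) as Hdp.
  set (r0 := Rmin (d / 2) rho).
  assert (Hr0 : 0 < r0) by (apply Rmin_pos; lra).
  assert (r0 <= d / 2) by apply Rmin_l. assert (r0 <= rho) by apply Rmin_r.
  assert (Hs : ln r0 <= ln rho) by now apply ln_le.
  pose proof PI_RGT_0.
  set (k := Rect (ln r0) (ln rho) 0 (2 * PI)).
  assert (Hclosed : forall s t, in_rectangle s t k -> exists px m qy,
    differentiable_pt_lim (fun s t => Im (G (polar s t))) s t px m /\
    differentiable_pt_lim (fun s t => Re (G (polar s t))) s t m qy).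
  { intros s t [Hst _]. simpl in Hst. apply polar_form_closed, HG.
    unfold unit_disc. rewrite Cmod_polar.
    apply Rle_lt_trans with rho; [| lra].
    rewrite <- (exp_ln rho) by lra.
    destruct (proj2 Hst) as [Hst' | ->]; [left; now apply exp_increasing | right; reflexivity]. }
  assert (Hcirc := goursat _ _ k Hclosed ltac:(unfold subrectangle; simpl; lra)).
  assert (HI : forall s, ln r0 <= s <= ln rho ->
            ex_RInt (fun t => Re (G (polar s t))) 0 (2 * PI)).
  { intros s Hs'. apply (ex_RInt_vertical (fun s t => Re (G (polar s t)))); [lra |].
    intros t Ht.
    destruct (Hclosed s t) as (px & m & qy & _ & HQ);
      [unfold in_rectangle; simpl; lra |].
    apply differentiable_continuity_pt. now exists m, qy. }
  assert (Hper : RInt (fun s => Im (G (polar s (2 * PI)))) (ln r0) (ln rho)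
               = RInt (fun s => Im (G (polar s 0))) (ln r0) (ln rho)).
  { apply (@RInt_ext R_CompleteNormedModule). intros s _. unfold polar.
    now rewrite cos_2PI, sin_2PI, cos_0, sin_0. }
  unfold circulation in Hcirc. simpl in Hcirc. rewrite Hper in Hcirc.
  assert (Hup : RInt (fun t => Re (G (polar (ln rho) t))) 0 (2 * PI)
                <= RInt (fun _ => M) 0 (2 * PI)).
  { apply RInt_le; [lra | apply HI; lra | apply ex_RInt_const |].
    intros t _. apply HM. rewrite Cmod_polar. apply exp_ln; lra. }
  assert (Hlow : RInt (fun _ => M + e) 0 (2 * PI)
                 <= RInt (fun t => Re (G (polar (ln r0) t))) 0 (2 * PI)).
  { apply RInt_le; [lra | apply ex_RInt_const | apply HI; lra |].
    intros t _.
    assert (Hc : Cmod (G (polar (ln r0) t) - G (RtoC 0)) < e).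
    { apply Hd. replace (polar (ln r0) t - RtoC 0)%C with (polar (ln r0) t) by ring.
      rewrite Cmod_polar, exp_ln; lra. }
    pose proof (re_le_Cmod (G (polar (ln r0) t) - G (RtoC 0))) as Hre.
    apply Rabs_le_between in Hre.
    unfold Re in *. simpl in Hre. unfold e in *. lra. }
  rewrite RInt_const in Hup, Hlow. unfold scal in Hup, Hlow; simpl in Hup, Hlow.
  unfold mult in Hup, Hlow; simpl in Hup, Hlow. nra.
Qed.

(** * The maximum principle and Schwarz's lemma *)

Lemma Cmod_center_le_circle (G : C -> C) (rho M : R) :
  analytic_on_disc G -> 0 < rho < 1 ->
  (forall z, Cmod z = rho -> Cmod (G z) <= M) ->
  Cmod (G (RtoC 0)) <= M.
Proof.
  intros HG Hrho HM.
  set (g := G (RtoC 0)).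
  assert (HM0 : 0 <= M).
  { eapply Rle_trans; [apply Cmod_ge_0 |]. apply (HM (RtoC rho)).
    rewrite Cmod_R. apply Rabs_pos_eq. lra. }
  destruct (Req_dec (Cmod g) 0) as [-> | Hg]; [exact HM0 |].
  pose proof (Cmod_ge_0 g) as Hg0.
  (* Multiplying by the conjugate of [G 0] rotates the value at the center to
     the positive real axis. *)
  assert (K : Re (Cconj g * G (RtoC 0))%C <= Cmod g * M).
  { apply (Re_center_le_circle (fun z => Cconj g * G z)%C rho); [| exact Hrho |].
    - intros z Hz. apply C_diff_mult; [apply C_diff_const | exact (HG z Hz)].
    - intros z Hz. eapply Rle_trans; [apply Rle_abs |].
      eapply Rle_trans; [apply re_le_Cmod |].
      rewrite Cmod_mult, Cmod_conj. apply Rmult_le_compat_l; [exact Hg0 | now apply HM]. }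
  fold g in K. replace (Re (Cconj g * g)%C) with (Cmod g * Cmod g) in K.
  - nra.
  - pose proof (Cmod2_alt g) as E. unfold Re, Im in *. simpl in *. nra.
Qed.

(** The disc automorphism taking 0 to [a]. *)
Definition moebius (a w : C) : C := ((w + a) / (1 + Cconj a * w))%C.

Lemma moebius_denominator (a w : C) : Cmod a < 1 -> Cmod w < 1 ->
  1 - Cmod a <= Cmod (1 + Cconj a * w)%C.
Proof.
  intros Ha Hw.
  pose proof (Cmod_reverse_triangle 1 (- (Cconj a * w))) as H.
  replace (1 - - (Cconj a * w))%C with (1 + Cconj a * w)%C in H by ring.
  rewrite Cmod_opp, Cmod_mult, Cmod_conj, Cmod_1 in H.
  pose proof (Cmod_ge_0 a). pose proof (Cmod_ge_0 w). nra.
Qed.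

(** This identity turns closeness of [w] to the unit circle into closeness of
    [moebius a w] to it. *)
Lemma moebius_identity (a w : C) : Cmod a < 1 -> Cmod w < 1 ->
  (1 - Cmod (moebius a w) ^ 2) * Cmod (1 + Cconj a * w)%C ^ 2
  = (1 - Cmod a ^ 2) * (1 - Cmod w ^ 2).
Proof.
  intros Ha Hw. pose proof (moebius_denominator a w Ha Hw) as Hd.
  unfold moebius. rewrite Cmod_div by (apply Cmod_gt_0; lra).
  replace ((1 - (Cmod (w + a) / Cmod (1 + Cconj a * w)) ^ 2)
           * Cmod (1 + Cconj a * w) ^ 2)
    with (Cmod (1 + Cconj a * w)%C ^ 2 - Cmod (w + a)%C ^ 2) by (field; lra).
  rewrite !Cmod2_alt. unfold Re, Im. simpl. ring.
Qed.

(** The mean value inequality on a circle close to the boundary, transported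
    by the automorphism that takes its center to [a]. *)
Lemma maximum_principle (G : C -> C) (r0 M : R) :
  analytic_on_disc G -> 0 <= r0 < 1 ->
  (forall z, r0 <= Cmod z < 1 -> Cmod (G z) <= M) ->
  forall a, unit_disc a -> Cmod (G a) <= M.
Proof.
  intros HG Hr0 HM a Ha. unfold unit_disc in Ha.
  pose proof (Cmod_ge_0 a) as Ha0.
  assert (Hphi : forall w, Cmod w < 1 -> Cmod (moebius a w) < 1).
  { intros w Hw. pose proof (moebius_identity a w Ha Hw) as E.
    pose proof (moebius_denominator a w Ha Hw) as D.
    pose proof (Cmod_ge_0 w). pose proof (Cmod_ge_0 (moebius a w)).
    set (d := Cmod (1 + Cconj a * w)%C) in *. set (m := Cmod (moebius a w)) in *.
    assert (0 < (1 - Cmod a ^ 2) * (1 - Cmod w ^ 2))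
      by (apply Rmult_lt_0_compat; nra).
    assert (0 < d ^ 2) by (apply pow_lt; lra).
    assert (0 < 1 - m ^ 2) by nra. nra. }
  assert (Hcenter : moebius a (RtoC 0) = a).
  { unfold moebius. rewrite Cmult_0_r, Cplus_0_l, Cplus_0_r. field. }
  rewrite <- Hcenter.
  (* The radius is chosen with [1 - rho^2 = kappa / 2], small enough in the
     Moebius identity for the image of the circle to lie outside [|z| < r0]. *)
  set (kappa := (1 - r0 ^ 2) * (1 - Cmod a) ^ 2).
  assert (0 < (1 - Cmod a) ^ 2) by (apply pow_lt; lra).
  assert (Hkappa : 0 < kappa <= 1) by (unfold kappa; split; [apply Rmult_lt_0_compat | ]; nra).
  assert (Hsq : sqrt (1 - kappa / 2) ^ 2 = 1 - kappa / 2) by (apply pow2_sqrt; lra).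
  assert (Hrho : 0 < sqrt (1 - kappa / 2) < 1).
  { pose proof (sqrt_lt_R0 (1 - kappa / 2)). split; [| nra]. apply sqrt_lt_R0. lra. }
  apply (Cmod_center_le_circle (fun w => G (moebius a w)) (sqrt (1 - kappa / 2)));
    [| exact Hrho |].
  - intros w Hw. apply (C_diff_comp G (moebius a)); [now apply HG, Hphi |].
    apply C_diff_div.
    + apply C_diff_plus; [apply C_diff_id | apply C_diff_const].
    + apply C_diff_plus; [apply C_diff_const |].
      apply C_diff_mult; [apply C_diff_const | apply C_diff_id].
    + apply Cmod_gt_0. pose proof (moebius_denominator a w Ha Hw). lra.
  - intros w Hw. apply HM.
    assert (Hw1 : Cmod w < 1) by lra.
    split; [| now apply Hphi].
    pose proof (moebius_identity a w Ha Hw1) as E.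
    pose proof (moebius_denominator a w Ha Hw1) as D.
    pose proof (Cmod_ge_0 (moebius a w)).
    rewrite Hw, Hsq in E.
    set (d := Cmod (1 + Cconj a * w)%C) in *. set (m := Cmod (moebius a w)) in *.
    assert (Hd : (1 - Cmod a) ^ 2 <= d ^ 2) by (apply pow_incr; lra).
    apply Rnot_lt_le. intros Hlt.
    assert (m ^ 2 < r0 ^ 2) by nra.
    assert ((1 - r0 ^ 2) * (1 - Cmod a) ^ 2 <= (1 - r0 ^ 2) * d ^ 2)
      by (apply Rmult_le_compat_l; [nra | exact Hd]).
    assert ((1 - r0 ^ 2) * d ^ 2 < (1 - m ^ 2) * d ^ 2)
      by (apply Rmult_lt_compat_r; lra).
    fold kappa in H2. nra.
Qed.

(** [z (f(z)/z)^n].  The value at 0 is 0 whatever the quotient is there, and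
    the extra factor [z] makes the function differentiable at 0, with
    derivative [f'(0)^n], so that no singularity has to be removed. *)
Definition quotient_power (f : C -> C) (n : nat) (z : C) : C :=
  (z * (f z / z) ^ n)%C.

Lemma quotient_power_analytic (f : C -> C) (n : nat) :
  analytic_on_disc f -> f (RtoC 0) = RtoC 0 ->
  analytic_on_disc (quotient_power f n).
Proof.
  intros Hf H0 z Hz. destruct (Req_dec (Cmod z) 0) as [Ez | Nz].
  - apply Cmod_eq_0 in Ez. subst z.
    destruct (proj1 (C_diff_iff f _) (Hf _ Hz)) as [l Hl].
    apply C_diff_iff. exists (l ^ n)%C. intros eps.
    destruct (C_diff_continuous (fun w => w ^ n)%C l
                (C_diff_pow _ n l (C_diff_id l)) eps) as [d Hd].
    assert (Hd2 : 0 < d / 2) by (generalize (cond_pos d); lra).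
    destruct (Hl (mkposreal _ Hd2)) as [d' Hd']. simpl in Hd'.
    exists d'. intros w Hw. specialize (Hd' w Hw).
    replace (w - RtoC 0)%C with w in * by ring.
    unfold quotient_power. rewrite Cmult_0_l.
    destruct (Req_dec (Cmod w) 0) as [Ew | Nw].
    + apply Cmod_eq_0 in Ew. subst w. rewrite !Cmult_0_l.
      replace (RtoC 0 - RtoC 0 - RtoC 0)%C with (RtoC 0) by ring.
      rewrite Cmod_0. lra.
    + pose proof (Cmod_ge_0 w) as Hw0.
      assert (Hw' : w <> RtoC 0) by (apply Cmod_gt_0; lra).
      assert (Hq : Cmod (f w / w - l) < d).
      { replace (f w / w - l)%C with ((f w - f (RtoC 0) - w * l) / w)%C
          by (rewrite H0; field; exact Hw').
        rewrite Cmod_div by exact Hw'.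
        apply Rle_lt_trans with (d / 2); [| lra].
        apply (Rmult_le_reg_r (Cmod w)); [lra |].
        unfold Rdiv at 1. rewrite Rmult_assoc, Rinv_l, Rmult_1_r by lra. exact Hd'. }
      specialize (Hd _ Hq).
      replace (w * (f w / w) ^ n - RtoC 0 - w * l ^ n)%C
        with (w * ((f w / w) ^ n - l ^ n))%C by ring.
      rewrite Cmod_mult, Rmult_comm. apply Rmult_le_compat_r; lra.
  - assert (Hz' : z <> RtoC 0) by (apply Cmod_gt_0; generalize (Cmod_ge_0 z); lra).
    apply C_diff_mult; [apply C_diff_id |].
    apply C_diff_pow, C_diff_div; [exact (Hf z Hz) | apply C_diff_id | exact Hz'].
Qed.

(** The maximum principle bounds [|a| (|f(a)|/|a|)^n] by [r0^(-n)] for every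
    [r0 < 1] and every [n], which forces [|f(a)| <= |a|]. *)
Lemma schwarz_lemma (f : C -> C) :
  analytic_on_disc f -> f (RtoC 0) = RtoC 0 ->
  (forall z, unit_disc z -> Cmod (f z) <= 1) ->
  forall a, unit_disc a -> Cmod (f a) <= Cmod a.
Proof.
  intros Hf H0 H1 a Ha.
  destruct (Req_dec (Cmod a) 0) as [Ea | Na].
  { apply Cmod_eq_0 in Ea. subst a. rewrite H0. lra. }
  pose proof (Cmod_ge_0 a) as Ha0. assert (Hap : 0 < Cmod a) by lra.
  assert (Ha' : a <> RtoC 0) by now apply Cmod_gt_0.
  apply Rnot_lt_le. intros Hlt.
  set (q := Cmod (f a) / Cmod a).
  assert (Hq : 1 < q).
  { unfold q. apply (Rmult_lt_reg_r (Cmod a)); [exact Hap |].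
    unfold Rdiv. rewrite Rmult_assoc, Rinv_l by lra. lra. }
  (* A radius between [1/q] and 1. *)
  set (r0 := (q + 1) / (2 * q)).
  assert (Hr0q : r0 * q = (q + 1) / 2) by (unfold r0; field; lra).
  assert (Hr0 : 0 < r0 < 1) by (split; nra).
  assert (K : forall n, Cmod a * (r0 * q) ^ n <= 1).
  { intros n. rewrite Rpow_mult_distr.
    assert (P : 0 < r0 ^ n) by (apply pow_lt; lra).
    assert (B : Cmod (quotient_power f n a) <= / r0 ^ n).
    { apply (maximum_principle _ r0); [now apply quotient_power_analytic | lra | | exact Ha].
      intros z [Hz Hz1]. unfold quotient_power.
      assert (z <> RtoC 0) by (apply Cmod_gt_0; lra).
      rewrite Cmod_mult, Cmod_pow, Cmod_div by assumption.
      rewrite <- (Rmult_1_l (/ r0 ^ n)), <- pow_inv.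
      apply Rmult_le_compat; [apply Cmod_ge_0 | | lra |].
      - apply pow_le, Rdiv_le_0_compat; [apply Cmod_ge_0 | lra].
      - apply pow_incr. split; [apply Rdiv_le_0_compat; [apply Cmod_ge_0 | lra] |].
        rewrite <- (Rmult_1_l (/ r0)). apply Rmult_le_compat.
        + apply Cmod_ge_0.
        + apply Rlt_le, Rinv_0_lt_compat. lra.
        + now apply H1.
        + apply Rinv_le_contravar; lra. }
    unfold quotient_power in B. rewrite Cmod_mult, Cmod_pow, Cmod_div in B by exact Ha'.
    fold q in B. apply (Rmult_le_compat_r (r0 ^ n)) in B; [| lra].
    rewrite Rinv_l in B by lra. lra. }
  destruct (Pow_x_infinity (r0 * q)) with (b := 2 / Cmod a) as [N HN].
  { rewrite Rabs_pos_eq; nra. }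
  specialize (HN N (Nat.le_refl N)). specialize (K N).
  rewrite Rabs_pos_eq in HN by (apply pow_le; nra).
  apply Rge_le, (Rmult_le_compat_l (Cmod a)) in HN; [| lra].
  replace (Cmod a * (2 / Cmod a)) with 2 in HN by (field; lra). lra.
Qed.

(** * The disc of values *)

Definition disc_center (lambda r : R) : C :=
  (RtoC (1 / (1 - r ^ 2)) + RtoC (r ^ 2 / (1 - r ^ 2)) * expi (- (2 * lambda)))%C.

Definition disc_radius (lambda r : R) : R := 2 * r * cos lambda / (1 - r ^ 2).

Lemma expi_double_opp (lambda : R) :
  expi (- (2 * lambda)) = (2 * cos lambda ^ 2 - 1, - (2 * sin lambda * cos lambda)).
Proof.
  unfold expi. rewrite cos_neg, sin_neg, sin_2a, cos_2a_cos. f_equal; ring.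
Qed.

Lemma sin_sq (x : R) : sin x ^ 2 = 1 - cos x ^ 2.
Proof. pose proof (sin2_cos2 x). unfold Rsqr in *. lra. Qed.

Lemma Re_disc_center (lambda r : R) : r ^ 2 < 1 ->
  Re (disc_center lambda r) = (1 + r ^ 2 * cos (2 * lambda)) / (1 - r ^ 2).
Proof.
  intros Hr. unfold disc_center, expi, Re. simpl. rewrite cos_neg. field. simpl in Hr. lra.
Qed.

Lemma Cmod_disc_center (lambda r : R) : r ^ 2 < 1 ->
  Cmod (disc_center lambda r)
  = sqrt ((1 - r ^ 2) ^ 2 + 4 * r ^ 2 * cos lambda ^ 2) / (1 - r ^ 2).
Proof.
  intros Hr.
  set (S := (1 - r ^ 2) ^ 2 + 4 * r ^ 2 * cos lambda ^ 2).
  replace (sqrt S / (1 - r ^ 2)) with (sqrt S / sqrt ((1 - r ^ 2) ^ 2))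
    by (rewrite sqrt_pow2; lra).
  rewrite <- sqrt_div_alt by (apply pow_lt; lra).
  unfold Cmod, S. f_equal. unfold disc_center. rewrite expi_double_opp.
  cbn [fst snd Cplus Cmult RtoC].
  pose proof (sin_sq lambda) as E.
  set (c := cos lambda) in *. set (s := sin lambda) in *.
  transitivity (((1 + r ^ 2 * (2 * c ^ 2 - 1)) ^ 2 + r ^ 4 * (4 * s ^ 2 * c ^ 2))
                / (1 - r ^ 2) ^ 2).
  - field. lra.
  - rewrite E. field. lra.
Qed.

Lemma disc_center_radius_sq (lambda r : R) : r ^ 2 < 1 ->
  Cmod (disc_center lambda r) ^ 2 - disc_radius lambda r ^ 2 = 1.
Proof.
  intros Hr. rewrite (Cmod_disc_center lambda r Hr). unfold disc_radius, Rdiv.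
  rewrite Rpow_mult_distr, pow2_sqrt.
  - field. lra.
  - pose proof (pow2_ge_0 (1 - r ^ 2)). pose proof (pow2_ge_0 (r * cos lambda)).
    rewrite Rpow_mult_distr in *. lra.
Qed.

Lemma A_bound_center_radius (lambda r : R) : r ^ 2 < 1 ->
  A_bound lambda r = Cmod (disc_center lambda r) + disc_radius lambda r.
Proof.
  intros Hr. rewrite (Cmod_disc_center lambda r Hr). unfold A_bound, disc_radius.
  field. lra.
Qed.

(** By [disc_center_radius_sq], the sum and the difference of [|c|] and [R]
    have product 1. *)
Lemma inv_A_bound_center_radius (lambda r : R) : r ^ 2 < 1 ->
  0 <= disc_radius lambda r ->
  1 / A_bound lambda r = Cmod (disc_center lambda r) - disc_radius lambda r.
Proof.
  intros Hr HR. rewrite (A_bound_center_radius lambda r Hr).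
  pose proof (disc_center_radius_sq lambda r Hr) as E.
  pose proof (Cmod_ge_0 (disc_center lambda r)).
  assert (0 < Cmod (disc_center lambda r)) by nra.
  apply (Rmult_eq_reg_r (Cmod (disc_center lambda r) + disc_radius lambda r)); [| lra].
  field_simplify; lra.
Qed.

(** * The Schwarz function of a member of the class *)

Lemma Re_expi_mult (lambda : R) (u : C) :
  Re (expi lambda * u)%C = cos lambda * Re u - sin lambda * Im u.
Proof. unfold expi, Re, Im. reflexivity. Qed.

(** [-e^(-2 i lambda)] is the reflection of 1 in the boundary of the half-plane
    [Re (e^(i lambda) u) > 0], so the points of the half-plane are nearer to 1. *)
Lemma half_plane_nearer_to_1 (lambda : R) (u : C) : 0 < cos lambda ->
  0 < Re (expi lambda * u)%C ->
  Cmod (u - 1)%C < Cmod (u + expi (- (2 * lambda)))%C.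
Proof.
  intros Hc. rewrite Re_expi_mult. intros Hu.
  apply sqrt_lt_1_alt. split; [apply Rplus_le_le_0_compat; apply pow2_ge_0 |].
  rewrite expi_double_opp. cbn [fst snd Cplus Cminus Copp RtoC].
  change (fst u) with (Re u). change (snd u) with (Im u).
  pose proof (sin_sq lambda) as E.
  set (c := cos lambda) in *. set (s := sin lambda) in *.
  assert (0 < c * (c * Re u - s * Im u)) by now apply Rmult_lt_0_compat.
  assert ((2 * c ^ 2 - 1) ^ 2 + (2 * s * c) ^ 2 = 1)
    by (replace ((2 * s * c) ^ 2) with (4 * s ^ 2 * c ^ 2) by ring; rewrite E; ring).
  nra.
Qed.

(** Squaring the ratio condition and completing the square gives a circle of
    Apollonius, whose center and radius are these. *)
Lemma apollonius_disc (lambda r : R) (u : C) : 0 < cos lambda -> 0 <= r < 1 ->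
  Cmod (u - 1)%C <= r * Cmod (u + expi (- (2 * lambda)))%C ->
  Cmod (u - disc_center lambda r)%C <= disc_radius lambda r.
Proof.
  intros Hc Hr Hu.
  assert (Hk : 0 < 1 - r ^ 2) by nra.
  apply (fun H => pow_incr _ _ 2 (conj (Cmod_ge_0 _) H)) in Hu.
  rewrite Rpow_mult_distr, !Cmod2_alt in Hu.
  rewrite <- (Rabs_pos_eq (Cmod _)) by apply Cmod_ge_0.
  assert (HR : 0 <= disc_radius lambda r)
    by (apply Rdiv_le_0_compat; [repeat apply Rmult_le_pos |]; lra).
  rewrite <- (Rabs_pos_eq (disc_radius lambda r)) by exact HR.
  apply Rsqr_le_abs_0. rewrite !Rsqr_pow2, Cmod2_alt.
  unfold disc_center, disc_radius. rewrite expi_double_opp in *.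
  unfold Re, Im in *. cbn [fst snd Cplus Cmult Cminus Copp RtoC] in *.
  pose proof (sin_sq lambda) as E.
  set (c := cos lambda) in *. set (s := sin lambda) in *.
  set (X := fst u) in *. set (Y := snd u) in *.
  apply (Rmult_le_reg_r ((1 - r ^ 2) ^ 2)); [now apply pow_lt |].
  transitivity ((4 * r ^ 2 * c ^ 2)); [| right; field; lra].
  transitivity (((1 - r ^ 2) * X - 1 - r ^ 2 * (2 * c ^ 2 - 1)) ^ 2
                + ((1 - r ^ 2) * Y + 2 * r ^ 2 * (s * c)) ^ 2); [right; field; lra |].
  apply (Rmult_le_compat_l (1 - r ^ 2)) in Hu; [| lra].
  assert (Es : (s * c) ^ 2 = (1 - c ^ 2) * c ^ 2) by (rewrite Rpow_mult_distr, E; ring).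
  pose proof (f_equal (Rmult (4 * r ^ 2)) Es).
  pose proof (f_equal (Rmult (4 * r ^ 4)) Es). lra.
Qed.

Lemma class_P_in_disc (lambda r : R) (p : C -> C) (z : C) : 0 < cos lambda ->
  class_P lambda p -> unit_disc z -> r = Cmod z ->
  Cmod (p z - disc_center lambda r)%C <= disc_radius lambda r.
Proof.
  intros Hc [[Hp H0] Hpos] Hz ->.
  set (e := expi (- (2 * lambda))).
  assert (Hlt : forall w, unit_disc w -> Cmod (p w - 1)%C < Cmod (p w + e)%C).
  { intros w Hw. apply half_plane_nearer_to_1; [exact Hc | now apply Hpos]. }
  assert (Hd : forall w, unit_disc w -> 0 < Cmod (p w + e)%C).
  { intros w Hw. eapply Rle_lt_trans; [apply Cmod_ge_0 | now apply Hlt]. }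
  apply apollonius_disc; [exact Hc | split; [apply Cmod_ge_0 | exact Hz] |].
  fold e. pose proof (Hd z Hz) as Hdz.
  assert (S : Cmod ((p z - 1) / (p z + e))%C <= Cmod z).
  { apply (schwarz_lemma (fun w => (p w - 1) / (p w + e))%C); [| | | exact Hz].
    - intros w Hw. apply C_diff_div.
      + apply C_diff_minus; [now apply Hp | apply C_diff_const].
      + apply C_diff_plus; [now apply Hp | apply C_diff_const].
      + now apply Cmod_gt_0, Hd.
    - rewrite H0. unfold Cdiv, Cminus. rewrite Cplus_opp_r. apply Cmult_0_l.
    - intros w Hw. rewrite Cmod_div by now apply Cmod_gt_0, Hd.
      apply (Rmult_le_reg_r (Cmod (p w + e))); [now apply Hd |].
      unfold Rdiv. rewrite Rmult_assoc, Rinv_l by (apply Rgt_not_eq; now apply Hd).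
      specialize (Hlt w Hw). lra. }
  rewrite Cmod_div in S by now apply Cmod_gt_0.
  apply (Rmult_le_compat_r (Cmod (p z + e))) in S; [| lra].
  unfold Rdiv in S. rewrite Rmult_assoc, Rinv_l in S by lra. lra.
Qed.

(** * The extremal functions *)

Lemma one_minus_neq_0 (w : C) : Cmod w < 1 -> (1 - w)%C <> RtoC 0.
Proof.
  intros Hw. apply Cmod_gt_0.
  pose proof (Cmod_reverse_triangle 1 w). rewrite Cmod_1 in H. lra.
Qed.

Lemma Re_p_ext_pos (lambda : R) (w : C) : 0 < cos lambda -> Cmod w < 1 ->
  0 < Re (expi lambda * p_ext lambda w)%C.
Proof.
  intros Hc Hw.
  pose proof (one_minus_neq_0 w Hw) as Hne. apply Cmod_gt_0 in Hne.
  assert (Hd : 0 < (1 - Re w) ^ 2 + Im w ^ 2).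
  { pose proof (pow_lt _ 2 Hne) as H. rewrite Cmod2_alt in H.
    unfold Re, Im in *. simpl in *. lra. }
  assert (Hw2 : 0 < 1 - Re w ^ 2 - Im w ^ 2).
  { pose proof (Cmod2_alt w). pose proof (Cmod_ge_0 w). nra. }
  replace (Re (expi lambda * p_ext lambda w)%C)
    with (cos lambda * (1 - Re w ^ 2 - Im w ^ 2) / ((1 - Re w) ^ 2 + Im w ^ 2)).
  - apply Rdiv_lt_0_compat; [apply Rmult_lt_0_compat |]; lra.
  - unfold p_ext. rewrite expi_double_opp, Re_expi_mult. unfold Re, Im in *.
    cbn [fst snd Cplus Cmult Cminus Copp RtoC Cdiv Cinv].
    pose proof (sin_sq lambda) as E.
    set (c := cos lambda) in *. set (s := sin lambda) in *.
    set (X := fst w) in *. set (Y := snd w) in *.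
    field_simplify_eq.
    + replace (s ^ 2) with (1 - c ^ 2) by auto. ring.
    + nra.
Qed.

Lemma p_ext_rotation_class_P (lambda : R) (x : C) : 0 < cos lambda -> Cmod x = 1 ->
  class_P lambda (fun z => p_ext lambda (x * z)%C).
Proof.
  intros Hc Hx.
  assert (Hxz : forall z, unit_disc z -> Cmod (x * z)%C < 1).
  { intros z Hz. now rewrite Cmod_mult, Hx, Rmult_1_l. }
  repeat split.
  - intros z Hz.
    assert (L : C_diff (fun z => x * z)%C z)
      by (apply C_diff_mult; [apply C_diff_const | apply C_diff_id]).
    apply C_diff_div.
    + apply C_diff_plus; [apply C_diff_const |].
      apply C_diff_mult; [apply C_diff_const | exact L].
    + apply C_diff_minus; [apply C_diff_const | exact L].
    + now apply one_minus_neq_0, Hxz.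
  - unfold p_ext. rewrite !Cmult_0_r. field.
  - intros z Hz. apply Re_p_ext_pos; [exact Hc | now apply Hxz].
Qed.

Lemma expi_opp_mult (lambda : R) : (expi lambda * expi (- lambda))%C = RtoC 1.
Proof.
  unfold expi, Cmult, RtoC. rewrite cos_neg, sin_neg. simpl.
  pose proof (sin_sq lambda). f_equal; [| ring]. lra.
Qed.

Lemma expi_opp_sq (lambda : R) :
  expi (- (2 * lambda)) = (expi (- lambda) * expi (- lambda))%C.
Proof.
  unfold expi, Cmult. simpl. rewrite !cos_neg, !sin_neg, sin_2a, cos_2a. f_equal; ring.
Qed.

Lemma expi_plus_opp (lambda : R) :
  (expi lambda + expi (- lambda))%C = RtoC (2 * cos lambda).
Proof.
  unfold expi, Cplus, RtoC. rewrite cos_neg, sin_neg. simpl. f_equal; ring.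
Qed.

Lemma Cmod_expi (t : R) : Cmod (expi t) = 1.
Proof.
  transitivity (sqrt 1); [| apply sqrt_1]. unfold Cmod, expi. f_equal. simpl.
  pose proof (sin_sq t). lra.
Qed.

(** [p_ext] maps the circle of radius [r] onto the boundary of the disc.  The
    preimage [r (tau + r) / (1 + r tau)] comes from solving
    [1 / (1 - w) = (1 + r tau) / (1 - r^2)] with [tau = e^(i lambda) sigma]. *)
Lemma p_ext_attains_boundary (lambda r : R) (z sigma : C) :
  unit_disc z -> r = Cmod z -> Cmod sigma = 1 ->
  exists x : C, Cmod x = 1 /\
    p_ext lambda (x * z)%C
    = (disc_center lambda r + RtoC (disc_radius lambda r) * sigma)%C.
Proof.
  intros Hz Er Hsigma. unfold unit_disc in Hz.
  assert (Hr : 0 <= r < 1) by (rewrite Er; split; [apply Cmod_ge_0 | exact Hz]).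
  set (tau := (expi lambda * sigma)%C).
  assert (Htau : Cmod tau = 1) by (unfold tau; rewrite Cmod_mult, Cmod_expi; lra).
  assert (Hden : (1 + RtoC r * tau)%C <> RtoC 0).
  { replace (1 + RtoC r * tau)%C with (1 - - (RtoC r * tau))%C by ring.
    apply one_minus_neq_0. rewrite Cmod_opp, Cmod_mult, Htau, Cmod_R, Rabs_pos_eq; lra. }
  set (w := (RtoC r * (tau + RtoC r) / (1 + RtoC r * tau))%C).
  assert (Hw : Cmod w = r).
  { unfold w. rewrite Cmod_div, Cmod_mult, Cmod_R, Rabs_pos_eq by (auto; lra).
    replace (Cmod (tau + RtoC r)) with (Cmod (1 + RtoC r * tau)%C).
    - field. apply Rgt_not_eq. now apply Cmod_gt_0.
    - pose proof (Cmod2_alt tau) as T. rewrite Htau in T.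
      unfold Cmod. f_equal. unfold Re, Im in T. simpl in *.
      pose proof (f_equal (Rmult (1 - r * r)) T). lra. }
  assert (Hx : exists x, Cmod x = 1 /\ (x * z)%C = w).
  { destruct (Req_dec r 0) as [E0 | N0].
    - exists (RtoC 1). split; [apply Cmod_1 |].
      rewrite Er in E0. rewrite (Cmod_eq_0 z E0).
      rewrite (Cmod_eq_0 w) by lra. ring.
    - assert (z <> RtoC 0) by (apply Cmod_gt_0; lra).
      exists (w / z)%C. split.
      + rewrite Cmod_div by assumption. rewrite Hw, <- Er. field. exact N0.
      + field. assumption. }
  destruct Hx as (x & Hx1 & Hxz). exists x. split; [exact Hx1 |]. rewrite Hxz.
  assert (Hk : 1 - r ^ 2 <> 0) by nra.
  assert (HkC : (1 - RtoC r * RtoC r)%C <> RtoC 0).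
  { replace (RtoC r * RtoC r)%C with (RtoC (r * r)) by apply RtoC_mult.
    apply one_minus_neq_0. rewrite Cmod_R, Rabs_pos_eq; nra. }
  assert (E1 : (1 - w)%C = ((1 - RtoC r * RtoC r) / (1 + RtoC r * tau))%C)
    by (unfold w; field; exact Hden).
  unfold p_ext. rewrite E1. unfold w.
  unfold disc_center, disc_radius.
  replace (2 * r * cos lambda / (1 - r ^ 2)) with (r / (1 - r ^ 2) * (2 * cos lambda))
    by (field; exact Hk).
  rewrite RtoC_mult, <- expi_plus_opp, expi_opp_sq.
  rewrite !RtoC_div by exact Hk. rewrite RtoC_minus, RtoC_pow.
  pose proof (expi_opp_mult lambda) as E. unfold tau in *.
  set (a := expi lambda) in *. set (b := expi (- lambda)) in *.
  assert (Ha : a <> RtoC 0) by (intros Ha; rewrite Ha, Cmult_0_l in E; now apply C1_nz).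
  replace b with (/ a)%C
    by (rewrite <- (Cmult_1_r (/ a)), <- E; field; exact Ha).
  assert (HkC' : (1 - RtoC r ^ 2)%C <> RtoC 0)
    by (replace (RtoC r ^ 2)%C with (RtoC r * RtoC r)%C by ring; exact HkC).
  field. repeat split; auto.
Qed.
Theorem theorem5 (lambda : R) (hlambda : - (PI / 2) < lambda < PI / 2) :
  (forall (p : C -> C) (z : C) (r : R),
     class_P lambda p -> unit_disc z -> r = Cmod z ->
     Cmod (p z - (RtoC (1 / (1 - r ^ 2))
                  + RtoC (r ^ 2 / (1 - r ^ 2)) * expi (- (2 * lambda))))%C
       <= 2 * r * cos lambda / (1 - r ^ 2)
     /\ (1 + r ^ 2 * cos (2 * lambda) - 2 * r * cos lambda) / (1 - r ^ 2)
          <= Re (p z)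
     /\ Re (p z)
          <= (1 + r ^ 2 * cos (2 * lambda) + 2 * r * cos lambda) / (1 - r ^ 2)
     /\ 1 / A_bound lambda r <= Cmod (p z)
     /\ Cmod (p z) <= A_bound lambda r)
  /\
  (forall x : C, Cmod x = 1 ->
     class_P lambda (fun z : C => p_ext lambda (x * z)%C))
  /\
  (forall (z : C) (r : R), unit_disc z -> r = Cmod z ->
     (exists x : C, Cmod x = 1 /\
        Cmod (p_ext lambda (x * z)%C
              - (RtoC (1 / (1 - r ^ 2))
                 + RtoC (r ^ 2 / (1 - r ^ 2)) * expi (- (2 * lambda))))%C
        = 2 * r * cos lambda / (1 - r ^ 2))
     /\ (exists x : C, Cmod x = 1 /\
           (1 + r ^ 2 * cos (2 * lambda) - 2 * r * cos lambda) / (1 - r ^ 2)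
           = Re (p_ext lambda (x * z)%C))
     /\ (exists x : C, Cmod x = 1 /\
           Re (p_ext lambda (x * z)%C)
           = (1 + r ^ 2 * cos (2 * lambda) + 2 * r * cos lambda) / (1 - r ^ 2))
     /\ (exists x : C, Cmod x = 1 /\
           1 / A_bound lambda r = Cmod (p_ext lambda (x * z)%C))
     /\ (exists x : C, Cmod x = 1 /\
           Cmod (p_ext lambda (x * z)%C) = A_bound lambda r)).
Proof.
  assert (Hc : 0 < cos lambda) by (apply cos_gt_0; lra).
  assert (Hr2 : forall (z : C) (r : R), unit_disc z -> r = Cmod z ->
            r ^ 2 < 1 /\ 0 <= disc_radius lambda r).
  { intros z r Hz ->. unfold unit_disc in Hz. pose proof (Cmod_ge_0 z).
    split; [nra |]. apply Rdiv_le_0_compat; [repeat apply Rmult_le_pos |]; nra. }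
  assert (Hre : forall r, r ^ 2 < 1 ->
    (1 + r ^ 2 * cos (2 * lambda) - 2 * r * cos lambda) / (1 - r ^ 2)
      = Re (disc_center lambda r) - disc_radius lambda r /\
    (1 + r ^ 2 * cos (2 * lambda) + 2 * r * cos lambda) / (1 - r ^ 2)
      = Re (disc_center lambda r) + disc_radius lambda r).
  { intros r Hr. rewrite (Re_disc_center lambda r Hr). unfold disc_radius.
    split; field; lra. }
  split; [| split].
  - intros p z r Hp Hz Er.
    destruct (Hr2 z r Hz Er) as [Hr HR]. destruct (Hre r Hr) as [-> ->].
    rewrite (inv_A_bound_center_radius lambda r Hr HR).
    rewrite (A_bound_center_radius lambda r Hr).
    pose proof (class_P_in_disc lambda r p z Hc Hp Hz Er) as D.
    pose proof (re_le_Cmod (p z - disc_center lambda r)) as Hdre.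
    apply Rabs_le_between in Hdre.
    change (Re (p z - disc_center lambda r)%C)
      with (Re (p z) - Re (disc_center lambda r)) in Hdre.
    pose proof (Cmod_reverse_triangle (p z) (disc_center lambda r)) as T1.
    pose proof (Cmod_reverse_triangle (disc_center lambda r) (p z)) as T2.
    rewrite <- (Cmod_opp (disc_center lambda r - p z)) in T2.
    replace (- (disc_center lambda r - p z))%C
      with (p z - disc_center lambda r)%C in T2 by ring.
    split; [exact D | repeat split; lra].
  - intros x Hx. now apply p_ext_rotation_class_P.
  - intros z r Hz Er.
    destruct (Hr2 z r Hz Er) as [Hr HR]. destruct (Hre r Hr) as [-> ->].
    rewrite (inv_A_bound_center_radius lambda r Hr HR).
    rewrite (A_bound_center_radius lambda r Hr).
    pose proof (disc_center_radius_sq lambda r Hr) as Esq.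
    pose proof (Cmod_ge_0 (disc_center lambda r)) as Hm0.
    set (m := Cmod (disc_center lambda r)) in *.
    assert (Hm : disc_radius lambda r < m) by nra.
    assert (Hd0 : RtoC m <> RtoC 0) by (intros E; injection E; lra).
    (* The direction of the center, in which the modulus is extremal. *)
    set (u := (disc_center lambda r / RtoC m)%C).
    assert (Hu : Cmod u = 1).
    { unfold u. rewrite Cmod_div, Cmod_R, Rabs_pos_eq by (auto; lra).
      fold m. field. lra. }
    assert (Emod : forall t, 0 <= m + t ->
              Cmod (disc_center lambda r + RtoC t * u)%C = m + t).
    { intros t Ht. replace (disc_center lambda r + RtoC t * u)%C with (RtoC (m + t) * u)%C.
      - rewrite Cmod_mult, Hu, Cmod_R, Rabs_pos_eq; lra.
      - rewrite RtoC_plus. unfold u. field. exact Hd0. }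
    assert (Hplus := fun s => p_ext_attains_boundary lambda r z s Hz Er).
    destruct (Hplus (RtoC 1) Cmod_1) as (x1 & Hx1 & E1).
    destruct (Hplus (- RtoC 1)%C Cmod_m1) as (x2 & Hx2 & E2).
    destruct (Hplus u Hu) as (x3 & Hx3 & E3).
    destruct (Hplus (- u)%C ltac:(now rewrite Cmod_opp)) as (x4 & Hx4 & E4).
    split; [| split; [| split; [| split]]].
    + exists x1. split; [exact Hx1 |]. rewrite E1.
      change (Cmod (disc_center lambda r + RtoC (disc_radius lambda r) * RtoC 1
                    - disc_center lambda r)%C = disc_radius lambda r).
      replace (disc_center lambda r + RtoC (disc_radius lambda r) * RtoC 1
               - disc_center lambda r)%C with (RtoC (disc_radius lambda r)) by ring.
      rewrite Cmod_R. now apply Rabs_pos_eq.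
    + exists x2. split; [exact Hx2 |]. rewrite E2. unfold Re. simpl. ring.
    + exists x1. split; [exact Hx1 |]. rewrite E1. unfold Re. simpl. ring.
    + exists x4. split; [exact Hx4 |]. rewrite E4. unfold Rminus.
      replace (RtoC (disc_radius lambda r) * - u)%C
        with (RtoC (- disc_radius lambda r) * u)%C by (rewrite RtoC_opp; ring).
      rewrite Emod; [reflexivity | lra].
    + exists x3. split; [exact Hx3 |]. rewrite E3. apply Emod. lra.
Qed.
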